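(* Let $V$ be a vertex operator algebra and let $G$ be a compact Lie group of automorphisms of $V$. Let $X$ be a homogeneous subspace of a $G$-invariant module of $V$. If the minimal weight of the fixed point vertex operator algebra $V^G$ is larger than or equal to $t+1$, then $X$ is a conformal $t$-design based on $V$.
   Context: Conventions. A vertex operator algebra $V$ over $\mathbf{C}$ has vertex operators $Y(v,z)=\sum_{n\in\mathbf{Z}}v_{(n)}z^{-n-1}$, vacuum $\mathbf 1$ and Virasoro vector $\omega$; the operators $L_n=\omega_{(n+1)}$ satisfy the Virasoro relations with central charge $c$; $V=\bigoplus_{n\ge 0}V_n$ is the grading by $L_0$-eigenvalues, with $\dim V_n<\infty$ and $V_0=\mathbf{C}\mathbf 1$. Standing assumptions: $V$ is $C_2$-cofinite, i.e. $V/\mathrm{Span}\{x_{(-2)}y\mid x,y\in V\}$ is finite-dimensional, and $V$ is a direct sum of highest weight modules for the Virasoro algebra. Hence $V=\bigoplus_{h\ge 0}\overline M(h)$, where $\overline M(h)$ is a direct sum of finitely many quotients of the Verma module $M(c,h)$ of central charge $c$ and highest weight $h$, and $\overline M(0)=V_\omega$ is the vertex operator subalgebra generated by $\omega$. Let $\pi:V\to V_\omega$ be the projection with kernel $\bigoplus_{h>0}\overline M(h)$. The minimal weight $\mu(V)$ is the smallest $h>0$ with $\overline M(h)\neq 0$ (and $\infty$ if there is none). Modules are graded by $L_0$-eigenvalues with finite-dimensional homogeneous subspaces. For $v\in V_n$ put $\mathrm{o}(v)=v_{(n-1)}$, an operator preserving degree on any module. Conformal design: a homogeneous (degree $h$)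 subspace $X$ of a $V$-module is a conformal $t$-design ($t$ a positive integer; also called a conformal design of type $t$-$(c,h)$) based on $V$ if $\mathrm{tr}|_X\,\mathrm{o}(v)=\mathrm{tr}|_X\,\mathrm{o}(\pi(v))$ for all $v\in V_n$ with $0\le n\le t$. A group $G$ of automorphisms of $V$ fixes $\mathbf 1$ and $\omega$; $V^G$ is the subalgebra of $G$-fixed vectors (with the same Virasoro vector $\omega$). A $V$-module $N$ is $G$-invariant if there is a central extension $\widehat G$ of $G$ acting on $N$ such that $g^{-1}Y_N(\bar g v,z)g=Y_N(v,z)$ for all $g\in\widehat G$, $v\in V$, where $\bar g\in G$ is the image of $g$.
   Formalization: The projection π is assumed to be well defined, i.e. the same for every decomposition of V into highest weight modules (automatic if V_ω is a simple Virasoro module); for an arbitrary choice of decomposition the claim can fail. *)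

(* Defs.v *)
From HB Require Import structures.
From mathcomp Require Import all_boot all_order all_algebra.
From mathcomp Require Import all_classical all_reals all_analysis.
From mathcomp Require Import complex.
Set Implicit Arguments.
Unset Strict Implicit.
Unset Printing Implicit Defensive.
Import Order.TTheory GRing.Theory Num.Theory.
Import numFieldNormedType.Exports.
Local Open Scope classical_set_scope.
Local Open Scope ring_scope.
Local Open Scope complex_scope.

(** * Linear algebra in possibly infinite-dimensional spaces *)

Section LinearAlgebra.
Context {K : fieldType}.

Definition lin_subspace (V : lmodType K) (U : set V) : Prop :=
  U 0 /\ forall (a : K) u v, U u -> U v -> U (a *: u + v).

Definition lin_span (V : lmodType K) (S : set V) : set V :=
  smallest (@lin_subspace V) S.

Definition sum_of (V : lmodType K) (I : eqType) (W : I -> set V) : set V :=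
  [set v | exists (s : seq I) (w : I -> V),
     (forall i, W i (w i)) /\ v = \sum_(i <- s) w i].

Definition direct_sum (V : lmodType K) (I : eqType) (W : I -> set V)
    (U : set V) : Prop :=
  U = sum_of W /\
  forall (s : seq I) (w : I -> V), uniq s -> (forall i, W i (w i)) ->
    \sum_(i <- s) w i = 0 -> forall i, i \in s -> w i = 0.

Definition is_basis (V : lmodType K) (U : set V) n (b : 'I_n -> V) : Prop :=
  (forall i, U (b i)) /\
  forall v, U v -> exists! c : 'rV[K]_n, v = \sum_i c 0 i *: b i.

Definition finite_dim (V : lmodType K) (U : set V) : Prop :=
  exists n (b : 'I_n -> V), is_basis U b.

(* The quotient of V by U is spanned by finitely many classes. *)
Definition finite_codim (V : lmodType K) (U : set V) : Prop :=
  exists n (b : 'I_n -> V), forall v,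
    exists c : 'rV[K]_n, U (v - \sum_i c 0 i *: b i).

(* The trace of f on a finite-dimensional f-stable subspace X; the value does
   not depend on the basis, see [trace_onE]. *)
Definition trace_on (V : lmodType K) (X : set V) (f : V -> V) : K :=
  xget 0 [set a | exists n (b : 'I_n -> V) (A : 'M[K]_n),
    [/\ is_basis X b, forall j, f (b j) = \sum_i A i j *: b i & a = \tr A]].

Lemma is_basis_inj (V : lmodType K) (X : set V) n (b : 'I_n -> V)
    (c d : 'I_n -> K) :
  lin_subspace X -> is_basis X b ->
  \sum_i c i *: b i = \sum_i d i *: b i -> forall i, c i = d i.
Proof.
move=> [X0 XS] [Xb ub] cd i.
have Xs : X (\sum_i c i *: b i).
  by apply: big_ind => [//|x y Xx Xy|j _];
    [rewrite -[x]scale1r; exact: XS | rewrite -[_ *: _]addr0; exact: XS].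
have [e [_ eu]] := ub _ Xs.
have /(congr1 (fun x : 'rV_n => x 0 i)) : e = \row_i c i.
  by apply: eu; apply: eq_bigr => j _; rewrite mxE.
have /(congr1 (fun x : 'rV_n => x 0 i)) : e = \row_i d i.
  by apply: eu; rewrite cd; apply: eq_bigr => j _; rewrite mxE.
by rewrite !mxE => -> ->.
Qed.

Lemma trace_onE (V : lmodType K) (X : set V) (f : V -> V) n (b : 'I_n -> V)
    (A : 'M[K]_n) :
  lin_subspace X -> linear f -> is_basis X b ->
  (forall j, f (b j) = \sum_i A i j *: b i) -> trace_on X f = \tr A.
Proof.
move=> Xsub lf Xb fA; rewrite /trace_on.
case: xgetP => [a -> [m [b' [B [Xb' fB ->]]]]|]; last first.
  by move=> /(_ (\tr A)); case; exists n, b, A.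
have f0 : f 0 = 0.
  by have := lf (-1) 0 0; rewrite scaler0 addr0 scaleN1r addNr.
have fsum p (c : 'I_p -> K) (e : 'I_p -> V) :
    f (\sum_i c i *: e i) = \sum_i c i *: f (e i).
  by elim/big_rec2: _ => [//|i y x _ <-]; rewrite lf.
have cobasis p q (e : 'I_p -> V) (e' : 'I_q -> V) :
    is_basis X e -> is_basis X e' ->
    {P : 'M[K]_(p, q) | forall j, e' j = \sum_i P i j *: e i}.
  move=> [_ ue] [Xe' _].
  have h j : {c : 'rV[K]_p | e' j = \sum_i c 0 i *: e i}.
    by apply: cid; have [c [? _]] := ue _ (Xe' j); exists c.
  exists (\matrix_(i, j) (sval (h j)) 0 i) => j.
  by rewrite {1}(svalP (h j)); apply: eq_bigr => i _; rewrite mxE.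
have [P hP] := cobasis _ _ _ _ Xb Xb'.
have [Q hQ] := cobasis _ _ _ _ Xb' Xb.
have comp p q r (e : 'I_p -> V) (P1 : 'M[K]_(p, q)) (P2 : 'M[K]_(q, r)) j :
    \sum_k P2 k j *: (\sum_i P1 i k *: e i) = \sum_i (P1 *m P2) i j *: e i.
  under eq_bigr do rewrite scaler_sumr.
  rewrite exchange_big; apply: eq_bigr => i _ /=.
  rewrite mxE scaler_suml; apply: eq_bigr => k _.
  by rewrite scalerA mulrC.
have PQ : P *m Q = 1%:M.
  apply/matrixP => i j.
  apply: (is_basis_inj (c := fun i => (P *m Q) i j)
            (d := fun i => (1%:M : 'M[K]_n) i j) Xsub Xb).
  rewrite -comp; under eq_bigr do rewrite -hP.
  rewrite -hQ (bigD1 j)//= mxE eqxx scale1r big1 ?addr0// => k kj.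
  by rewrite mxE (negbTE kj) scale0r.
have AP : A *m P = P *m B.
  apply/matrixP => i j.
  apply: (is_basis_inj (c := fun i => (A *m P) i j)
            (d := fun i => (P *m B) i j) Xsub Xb).
  rewrite -!comp; under eq_bigr do rewrite -fA.
  under [RHS]eq_bigr do rewrite -hP.
  by rewrite -fsum -hP fB.
have QP : Q *m P = 1%:M.
  apply/matrixP => i j.
  apply: (is_basis_inj (c := fun i => (Q *m P) i j)
            (d := fun i => (1%:M : 'M[K]_m) i j) Xsub Xb').
  rewrite -comp; under eq_bigr do rewrite -hQ.
  rewrite -hP (bigD1 j)//= mxE eqxx scale1r big1 ?addr0// => k kj.
  by rewrite mxE (negbTE kj) scale0r.
by rewrite -[A]mulmx1 -PQ mulmxA AP -mulmxA mxtrace_mulC -mulmxA QP mulmx1.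
Qed.

End LinearAlgebra.

(** * Vertex operator algebras and modules *)

(* The generalized binomial coefficient m (m - 1) ... (m - j + 1) / j!. *)
Definition binz (F : fieldType) (m : int) (j : nat) : F :=
  (\prod_(i < j) (m - i%:Z)%:~R) / j`!%:R.

(* [Y u n v] stands for the mode u_(n) applied to v. *)
Section Modes.
Context {K : fieldType}.

(* The Borcherds (Jacobi) identity: both infinite sums have finitely many
   nonzero terms by lower truncation, so the identity is stated for all
   sufficiently long partial sums. *)
Record module_axioms (V N : lmodType K) (Y : V -> int -> V -> V) (vac : V)
    (YN : V -> int -> N -> N) : Prop := {
  modes_linearl : forall n w, linear (fun v => YN v n w);
  modes_linearr : forall v n, linear (YN v n);
  modes_truncation : forall v w, \forall n \near \oo, YN v n%:Z w = 0;
  modes_vacuum : forall n w, YN vac n w = if n == -1 then w else 0;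
  modes_borcherds : forall (m n k : int) (a b : V) (w : N),
    \forall M \near \oo,
      \sum_(j < M) binz K m j *: YN (Y a (n + j%:Z) b) (m + k - j%:Z) w =
      \sum_(j < M) ((-1) ^+ j * binz K n j) *:
        (YN a (m + n - j%:Z) (YN b (k + j%:Z) w) -
         (-1) ^ n *: YN b (n + k - j%:Z) (YN a (m + j%:Z) w))
}.

(* L_n = omega_(n+1), acting on a module. *)
Definition virop (V N : lmodType K) (YN : V -> int -> N -> N) (omega : V)
  (n : int) : N -> N := YN omega (n + 1).

Definition eigenspace0 (V N : lmodType K) (YN : V -> int -> N -> N) (omega : V)
  (h : K) : set N := [set w | virop YN omega 0 w = h *: w].

Record voa_axioms (V : lmodType K) (Y : V -> int -> V -> V) (vac omega : V)
    (c : K) : Prop := {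
  voa_adjoint : module_axioms Y vac Y;
  voa_creation : forall v, Y v (-1) vac = v;
  voa_creation0 : forall v (n : nat), Y v n%:Z vac = 0;
  voa_virasoro : forall (m n : int) v,
    let L := virop Y omega in
    L m (L n v) - L n (L m v) =
      (m - n)%:~R *: L (m + n) v +
      (if m + n == 0 then ((m ^+ 3 - m)%:~R / 12%:R * c) *: v else 0);
  voa_translation : forall v n w,
    Y (virop Y omega (-1) v) n w = - n%:~R *: Y v (n - 1) w;
  voa_grading :
    direct_sum (fun n : nat => eigenspace0 Y omega n%:R) [set: V];
  voa_finite_dim : forall n : nat, finite_dim (eigenspace0 Y omega n%:R);
  voa_vac_neq0 : vac != 0;
  voa_degree0 : eigenspace0 Y omega 0 = [set a *: vac | a in [set: K]]
}.

End Modes.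

Record voa (R : realType) := VOA {
  voa_space :> lmodType R[i];
  vertex_op : voa_space -> int -> voa_space -> voa_space;
  vacuum : voa_space;
  conformal_vector : voa_space;
  central_charge : R[i];
  voaP : voa_axioms vertex_op vacuum conformal_vector central_charge
}.
Arguments vertex_op {R} V u n v : rename.
Arguments vacuum {R} V : rename.
Arguments conformal_vector {R} V : rename.
Arguments central_charge {R} V : rename.

Record voa_module (R : realType) (V : voa R) := VOAModule {
  module_space :> lmodType R[i];
  module_op : V -> int -> module_space -> module_space;
  module_opP : module_axioms (vertex_op V) (vacuum V) module_op;
  module_grading :
    direct_sum (eigenspace0 module_op (conformal_vector V))
      [set: module_space];
  module_finite_dim : forall h,
    finite_dim (eigenspace0 module_op (conformal_vector V) h)
}.
Arguments module_op {R V} N v n w : rename.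

Section Voa.
Context {R : realType}.
Local Notation C := R[i].

Definition L (V : voa R) (n : int) : V -> V :=
  virop (vertex_op V) (conformal_vector V) n.

Definition homog (V : voa R) (n : nat) : set V :=
  eigenspace0 (vertex_op V) (conformal_vector V) n%:R.

Definition module_homog (V : voa R) (N : voa_module V) (h : C) : set N :=
  eigenspace0 (module_op N) (conformal_vector V) h.

Definition homogeneous_subspace (V : voa R) (N : voa_module V) (X : set N) :=
  exists h : C, X = @module_homog V N h.

Definition C2_cofinite (V : voa R) : Prop :=
  finite_codim
    (lin_span [set vertex_op V x (- 2%:Z) y | x in [set: V] & y in [set: V]]).

Definition vertex_subalgebra (V : voa R) (U : set V) : Prop :=
  [/\ lin_subspace U, U (vacuum V) &
      forall u n v, U u -> U v -> U (vertex_op V u n v)].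

Definition V_omega (V : voa R) : set V :=
  smallest (@vertex_subalgebra V) [set conformal_vector V].

Local Arguments V_omega V : clear implicits.

(** * Decompositions into highest weight modules for the Virasoro algebra *)

Definition vir_submodule (V : voa R) (U : set V) : Prop :=
  lin_subspace U /\ forall n v, U v -> U (L n v).

(* W is a nonzero quotient of the Verma module M(c, h), that is, the Virasoro
   submodule generated by a highest weight vector of weight h. *)
Definition hw_module (V : voa R) (h : nat) (W : set V) : Prop :=
  exists u : V,
    [/\ u != 0, L 0 u = h%:R *: u, forall n : nat, L n.+1%:Z u = 0 &
        W = smallest (@vir_submodule V) [set u]].

(* U is the direct sum of the M h, where M h is a direct sum of finitely many
   highest weight modules of weight h. *)
Definition hw_decomposition (V : voa R) (U : set V) (M : nat -> set V) : Prop :=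
  direct_sum M U /\
  forall h, exists k (W : 'I_k -> set V),
    (forall i, hw_module h (W i)) /\ direct_sum W (M h).

(* The minimal weight read off from the decomposition M; it is +oo if there is
   no nonzero M h with h > 0. *)
Definition minimal_weight (V : voa R) (M : nat -> set V) : \bar R :=
  ereal_inf [set h%:R%:E | h in [set h : nat | (0 < h)%N /\ M h <> [set 0]]].

Definition hw_kernel (V : voa R) (M : nat -> set V) : set V :=
  sum_of (fun h : nat => if h == 0%N then [set 0] else M h).

(* pi is the projection onto V_omega along the sum of the M h with h > 0, for
   some decomposition M of V. If V_omega is not a simple Virasoro module, this
   kernel may depend on M: a generator u of a highest weight module of weight
   h > 0 may be replaced by u + s for a singular vector s of V_omega annihilated
   by the annihilator of u. *)
Definition vacuum_projection (V : voa R) (pi : V -> V) : Prop :=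
  exists M : nat -> set V,
    [/\ hw_decomposition [set: V] M, linear pi, forall v, V_omega V (pi v),
        forall v, V_omega V v -> pi v = v &
        [set v | pi v = 0] = hw_kernel M].

(** * Conformal designs *)

Definition conformal_design (V : voa R) (pi : V -> V) (N : voa_module V)
    (t : nat) (X : set N) : Prop :=
  forall n : nat, (n <= t)%N -> forall v, homog n v ->
    trace_on X (module_op N v (n%:Z - 1)) =
    trace_on X (module_op N (pi v) (n%:Z - 1)).

End Voa.
Arguments L {R V} n v : rename.
Arguments homog {R} V n.
Arguments module_homog {R V} N h.
Arguments C2_cofinite {R} V.
Arguments V_omega {R} V.
Arguments vacuum_projection {R} V pi.

(** * Lie groups *)

#[short(type="topologicalGroupType")]
HB.structure Definition TopologicalGroup := {G of Topological G & Group G}.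

Section Lie.
Context {R : realType}.

Fixpoint Ck_on (m n : nat) (k : nat) (U : set 'rV[R]_m)
    (f : 'rV[R]_m -> 'rV[R]_n) : Prop :=
  match k with
  | 0 => forall x, U x -> {for x, continuous f}
  | k'.+1 => (forall x v, U x -> derivable f x v) /\
             forall v, Ck_on k' U (fun x => 'D_v f x)
  end.

Definition smooth_on (m n : nat) (U : set 'rV[R]_m)
    (f : 'rV[R]_m -> 'rV[R]_n) : Prop := forall k, Ck_on k U f.

Record chart (d : nat) (M : topologicalType) := Chart {
  chart_dom : set M;
  chart_map : M -> 'rV[R]_d;
  chart_inv : 'rV[R]_d -> M;
  chart_dom_open : open chart_dom;
  chart_img_open : open (chart_map @` chart_dom);
  chart_mapK : forall x, chart_dom x -> chart_inv (chart_map x) = x;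
  chart_map_cont : {within chart_dom, continuous chart_map};
  chart_inv_cont : {within chart_map @` chart_dom, continuous chart_inv}
}.

Definition chart_img d (M : topologicalType) (a : chart d M) : set 'rV[R]_d :=
  chart_map a @` chart_dom a.

Definition smooth_atlas d (M : topologicalType) (A : set (chart d M)) : Prop :=
  (forall x, exists2 a, A a & chart_dom a x) /\
  forall a b, A a -> A b ->
    smooth_on [set z | chart_img a z /\ chart_dom b (chart_inv a z)]
      (chart_map b \o chart_inv a).

Definition smooth_inv d (G : topologicalGroupType) (A : set (chart d G)) :=
  continuous (fun x : G => x^-1%g) /\
  forall a b, A a -> A b ->
    smooth_on [set z | chart_img a z /\ chart_dom b (chart_inv a z)^-1%g]
      (fun z => chart_map b (chart_inv a z)^-1%g).

(* A pair of points in two charts is read as a vector of length d + d. *)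
Definition smooth_mul d (G : topologicalGroupType) (A : set (chart d G)) :=
  continuous (fun p : G * G => (p.1 * p.2)%g) /\
  forall a b c, A a -> A b -> A c ->
    let mul (z : 'rV[R]_(d + d)) :=
      (chart_inv a (lsubmx z) * chart_inv b (rsubmx z))%g in
    smooth_on [set z | [/\ chart_img a (lsubmx z), chart_img b (rsubmx z) &
                           chart_dom c (mul z)]]
      (fun z => chart_map c (mul z)).

End Lie.

Definition lie_group (R : realType) (G : topologicalGroupType) : Prop :=
  [/\ hausdorff_space G, @second_countable G &
      exists d (A : set (@chart R d G)),
        [/\ smooth_atlas A, smooth_mul A & smooth_inv A]].

(** * Groups of automorphisms *)

Section Actions.
Context {R : realType}.

Definition linear_action (G : groupType) (W : lmodType R[i])
    (rho : G -> W -> W) : Prop :=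
  [/\ forall g, linear (rho g), forall w, rho 1%g w = w &
      forall g h w, rho (g * h)%g w = rho g (rho h w)].

Definition acts_by_automorphisms (G : groupType) (V : voa R)
    (rho : G -> V -> V) : Prop :=
  [/\ linear_action rho,
      forall g u n v,
        rho g (vertex_op V u n v) = vertex_op V (rho g u) n (rho g v),
      forall g, rho g (vacuum V) = vacuum V &
      forall g, rho g (conformal_vector V) = conformal_vector V].

(* All matrix coefficients are continuous. An automorphism preserves each
   finite-dimensional V_n, so this means that every V_n is a continuous
   representation of G. *)
Definition continuous_action (G : topologicalGroupType) (W : lmodType R[i])
    (rho : G -> W -> W) : Prop :=
  forall (l : {scalar W}) (w : W),
    continuous (fun g => complex.Re (l (rho g w))) /\
    continuous (fun g => complex.Im (l (rho g w))).

(* G is identified with its image in the automorphism group of V. *)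
Definition compact_lie_group_of_automorphisms (V : voa R)
    (G : topologicalGroupType) (rho : G -> V -> V) : Prop :=
  [/\ lie_group R G, compact [set: G], acts_by_automorphisms rho,
      forall g h, rho g =1 rho h -> g = h & continuous_action rho].

Definition fixed_points (V : voa R) (G : groupType) (rho : G -> V -> V) :
  set V := [set v | forall g, rho g v = v].

(* bar is the quotient map of the central extension E of G. *)
Definition G_invariant (V : voa R) (G : groupType) (rho : G -> V -> V)
    (N : voa_module V) : Prop :=
  exists (E : groupType) (bar : {multiplicative E -> G}) (sigma : E -> N -> N),
    [/\ forall g, exists x, bar x = g,
        forall x, bar x = 1%g -> forall y, commute x y,
        linear_action sigma &
        forall x v n w,
          sigma x^-1%g (module_op N (rho (bar x) v) n (sigma x w)) =
          module_op N v n w].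

End Actions.

(* Main.v *)
Require Import Defs.
From HB Require Import structures.
From mathcomp Require Import all_boot all_order all_algebra.
From mathcomp Require Import all_classical all_reals all_analysis.
From mathcomp Require Import complex.
From mathcomp Require Import ring lra zify.
Import Order.TTheory GRing.Theory Num.Theory.
Import numFieldNormedType.Exports.
Local Open Scope classical_set_scope.
Local Open Scope ring_scope.

Set Implicit Arguments.
Unset Strict Implicit.
Unset Printing Implicit Defensive.

(** The functional phi(v) = tr o(v) - tr o(pi(v)) on V_n, traces being taken on
    the homogeneous subspace X, has to vanish for n <= t.

    It is G-invariant.  An element of the central extension over g conjugates
    the zero mode of v into that of g v and preserves X, so tr o(g v) = tr o(v)
    ([trace_zero_mode_aut]).  The conjugate g pi g^-1 is again a projection
    onto V_omega along the complement given by some decomposition into highest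
    weight modules, so it equals pi by uniqueness; as g fixes V_omega pointwise,
    pi(g v) = g pi(v) = pi(v) ([vacuum_projection_aut]).

    It vanishes on the G-fixed vectors of V_n.  Since the weights h with
    0 < h <= t do not occur in V^G, a fixed vector is a sum of a vector of
    V_omega and of vectors from highest weight modules of weight > t, whose
    degrees all exceed t; a fixed vector of degree n <= t therefore lies in
    V_omega, where pi is the identity ([hw_decomposition_low_degree]).

    These two facts suffice, because a linear functional on a finite-dimensional
    continuous representation of a compact group vanishes as soon as it is
    invariant and vanishes on the fixed vectors
    ([compact_action_invariant_eq0]).  The classical argument averages v over G
    by means of the Haar measure.  Here the average is replaced by a minimum: if
    phi is not zero, the affine hyperplane phi = 1 is G-stable, and the function
    sup_g |g x|^2 attains its minimum on it at exactly one point, by compactness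
    and the parallelogram law; being unique, that point is fixed by G, although
    phi takes the value 1 there.  Only the boundedness of the matrices of the
    group elements enters ([real_invariant_functional_eq0]).

    The traces make sense because the zero mode of a homogeneous vector commutes
    with L_0 on every module; this follows from the Borcherds identity
    ([L0_mode_commutator], [module_translation]). *)

(** * Subspaces, linear maps, bases and traces *)

Section LinearAlgebra.
Context {K : fieldType}.

Section Subspace.
Context {V : lmodType K} {U : set V}.
Hypothesis subU : lin_subspace U.

Lemma subsp0 : U 0.
Proof. by case: subU. Qed.

Lemma subspD u v : U u -> U v -> U (u + v).
Proof. by case: subU => _ US Uu Uv; rewrite -[u]scale1r; exact: US. Qed.

Lemma subspZ a u : U u -> U (a *: u).
Proof. by case: subU => U0 US Uu; rewrite -[_ *: _]addr0; exact: US. Qed.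

Lemma subspB u v : U u -> U v -> U (u - v).
Proof. by move=> Uu Uv; rewrite -scaleN1r; apply: subspD => //; exact: subspZ.
Qed.

Lemma subsp_sum (I : Type) (s : seq I) (F : I -> V) :
  (forall i, U (F i)) -> U (\sum_(i <- s) F i).
Proof.
by move=> UF; apply: big_ind => //; [exact: subsp0|exact: subspD].
Qed.

End Subspace.

(** Linearity is a proposition about bare functions in the definitions of
    algebras and modules; bundling gives access to the theory of morphisms. *)
Lemma linear_pack (V W : lmodType K) (f : V -> W) :
  linear f -> {F : {linear V -> W} | f = F :> (V -> W)}.
Proof.
move=> lf.
by exists (HB.pack_for {linear V -> W} f (GRing.isLinear.Build _ _ _ _ f lf)).
Qed.

Section PropLinear.
Context {V W : lmodType K} {f : V -> W}.
Hypothesis lf : linear f.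

Lemma lin0 : f 0 = 0.
Proof. by have [F ->] := linear_pack lf; exact: raddf0. Qed.
Lemma linB u v : f (u - v) = f u - f v.
Proof. by have [F ->] := linear_pack lf; exact: raddfB. Qed.
Lemma linZ a u : f (a *: u) = a *: f u.
Proof. by have [F ->] := linear_pack lf; exact: linearZ. Qed.
Lemma lin_sum (I : Type) (s : seq I) (F : I -> V) :
  f (\sum_(i <- s) F i) = \sum_(i <- s) f (F i).
Proof. by have [g ->] := linear_pack lf; exact: raddf_sum. Qed.

Lemma image_subspace (U : set V) : lin_subspace U -> lin_subspace (f @` U).
Proof.
move=> sU; split; first by exists 0; [exact: subsp0|exact: lin0].
move=> a _ _ [u Uu <-] [v Uv <-]; exists (a *: u + v); last exact: lf.
by case: sU => _; apply.
Qed.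

Lemma preimage_subspace (U : set W) : lin_subspace U -> lin_subspace (f @^-1` U).
Proof.
move=> sU; split; first by rewrite /preimage/= lin0; exact: subsp0.
by move=> a u v Uu Uv; rewrite /preimage/= lf; case: sU => _; apply.
Qed.

End PropLinear.

Lemma exists_projection (V : lmodType K) (A B : set V) :
  lin_subspace A -> lin_subspace B -> (forall v, A v -> B v -> v = 0) ->
  (forall v, exists2 a, A a & B (v - a)) ->
  exists p : V -> V, [/\ linear p, forall v, A (p v) & forall v, A v -> p v = v].
Proof.
move=> sA sB AB0 spanAB.
have h v : {a | A a /\ B (v - a)} by apply: cid; have [a] := spanAB v; exists a.
pose p v := sval (h v).
have pA v : A (p v) by have [] := svalP (h v).
have pB v : B (v - p v) by have [] := svalP (h v).
have uniq v a : A a -> B (v - a) -> p v = a.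
  move=> Aa Ba; apply/eqP; rewrite -subr_eq0; apply/eqP/AB0; first exact: subspB.
  have -> : p v - a = (v - a) - (v - p v) by rewrite opprB [RHS]addrC addrA subrK.
  exact: subspB.
exists p; split => // [k u v|v Av]; apply: uniq => //.
- by case: sA => _; apply.
- rewrite opprD addrACA -scalerBr; case: sB => _; apply => //.
- by rewrite subrr; exact: subsp0.
Qed.

(** The default value 0 is never met on the span of the basis. *)
Definition coordf (V : lmodType K) n (b : 'I_n -> V) (v : V) : 'rV[K]_n :=
  xget 0 [set c : 'rV[K]_n | v = \sum_i c 0 i *: b i].

Section Basis.
Context {V : lmodType K} {U : set V} {n : nat} {b : 'I_n -> V}.
Hypothesis subU : lin_subspace U.
Hypothesis Ub : is_basis U b.

Lemma coordfE v : U v -> v = \sum_i coordf b v 0 i *: b i.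
Proof.
by move=> /Ub.2[c [vc _]]; rewrite /coordf; case: xgetP => // /(_ c).
Qed.

Lemma basis_sum (c : 'I_n -> K) : U (\sum_i c i *: b i).
Proof. by apply: subsp_sum => // i; apply: subspZ => //; exact: Ub.1. Qed.

Lemma coordf_eq v (c : 'rV[K]_n) : v = \sum_i c 0 i *: b i -> coordf b v = c.
Proof.
move=> vc; apply/rowP => i.
apply: (is_basis_inj (c := coordf b v 0) (d := c 0) subU Ub).
by rewrite -coordfE -?vc// vc; exact: basis_sum.
Qed.

Lemma coordfP a u v : U u -> U v ->
  coordf b (a *: u + v) = a *: coordf b u + coordf b v.
Proof.
move=> Uu Uv; apply: coordf_eq; rewrite {1}(coordfE Uu) {1}(coordfE Uv).
rewrite scaler_sumr -big_split/=; apply: eq_bigr => i _.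
by rewrite !mxE scalerDl scalerA.
Qed.

Lemma basis_matrix (f : V -> V) : (forall v, U v -> U (f v)) ->
  {A : 'M[K]_n | forall j, f (b j) = \sum_i A i j *: b i}.
Proof.
move=> Uf; exists (\matrix_(i, j) coordf b (f (b j)) 0 i) => j.
rewrite {1}(coordfE (Uf _ (Ub.1 j))).
by apply: eq_bigr => i _; rewrite mxE.
Qed.

End Basis.

Lemma trace_onP (V : lmodType K) (X : set V) (f g : V -> V) (a : K) :
  lin_subspace X -> finite_dim X -> linear f -> linear g ->
  (forall v, X v -> X (f v)) -> (forall v, X v -> X (g v)) ->
  trace_on X (fun v => a *: f v + g v) = a * trace_on X f + trace_on X g.
Proof.
move=> sX [n [b Xb]] lf lg Xf Xg.
have [A fA] := basis_matrix Xb Xf; have [B gB] := basis_matrix Xb Xg.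
rewrite (trace_onE sX lf Xb fA) (trace_onE sX lg Xb gB) -linearP.
apply: (trace_onE sX _ Xb) => [k u v|j].
  by rewrite lf lg !scalerDr !scalerA (mulrC k) addrACA.
rewrite fA gB scaler_sumr -big_split; apply: eq_bigr => i _ /=.
by rewrite !mxE scalerDl scalerA.
Qed.

(** In the image under s of a basis b, the conjugate of f has the matrix of f in
    the basis b. *)
Lemma trace_on_conj (V : lmodType K) (X : set V) (f s s' : V -> V) :
  lin_subspace X -> finite_dim X -> linear f -> linear s -> linear s' ->
  (forall v, X v -> X (f v)) -> (forall v, X v -> X (s v)) ->
  (forall v, X v -> X (s' v)) -> cancel s s' -> cancel s' s ->
  trace_on X (fun v => s (f (s' v))) = trace_on X f.
Proof.
move=> sX [n [b Xb]] lf ls ls' Xf Xs Xs' sK s'K.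
have [A fA] := basis_matrix Xb Xf; rewrite (trace_onE sX lf Xb fA).
apply: (trace_onE (b := s \o b) sX) => [k u v||j].
- by rewrite ls' lf ls.
- split => [i|v Xv]; first by apply: Xs; exact: Xb.1.
  have [c [vc uc]] := Xb.2 _ (Xs' _ Xv); exists c; split.
    rewrite -[LHS]s'K vc (lin_sum ls); apply: eq_bigr => i _.
    by rewrite (linZ ls).
  move=> d vd; apply: uc; rewrite vd (lin_sum ls'); apply: eq_bigr => i _.
  by rewrite (linZ ls') /= sK.
- rewrite /= sK fA (lin_sum ls); apply: eq_bigr => i _.
  by rewrite (linZ ls).
Qed.

End LinearAlgebra.

(** * Invariant functionals of bounded real matrix groups *)

Definition sqn (R : realType) n (x : 'rV[R]_n) : R := \sum_i x 0 i ^+ 2.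

Lemma sqn_ge0 (R : realType) n (x : 'rV[R]_n) : 0 <= sqn x.
Proof. by apply: sumr_ge0 => i _; exact: sqr_ge0. Qed.

Lemma coord_le_sqn (R : realType) n (x : 'rV[R]_n) i : x 0 i ^+ 2 <= sqn x.
Proof.
by rewrite /sqn (bigD1 i)//= lerDl; apply: sumr_ge0 => j _; exact: sqr_ge0.
Qed.

Lemma sqn_eq0 (R : realType) n (x : 'rV[R]_n) : sqn x <= 0 -> x = 0.
Proof.
move=> x0; apply/rowP => i; rewrite mxE; apply/eqP; rewrite -sqrf_eq0.
by rewrite eq_le sqr_ge0 andbT (le_trans (coord_le_sqn _ _)).
Qed.

Lemma sqn_parallelogram (R : realType) n (x y : 'rV[R]_n) :
  sqn (2%:R^-1 *: (x - y)) =
  (sqn x + sqn y) / 2%:R - sqn (2%:R^-1 *: (x + y)).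
Proof.
rewrite /sqn -big_split/= mulr_suml -sumrB; apply: eq_bigr => i _.
by rewrite !mxE; field.
Qed.

Lemma coord_mulmx_le (R : realType) n (B d : R) (x : 'rV[R]_n) (g : 'M[R]_n) j :
  (forall i k, `|g i k| <= B) -> (forall i, `|x 0 i| <= d) ->
  `|(x *m g) 0 j| <= n%:R * (d * B).
Proof.
move=> gB xd; rewrite mxE (le_trans (ler_norm_sum _ _ _))//.
rewrite (le_trans (ler_sum _ (G := fun=> d * B) _))//.
  by move=> i _; rewrite normrM ler_pM.
by rewrite sumr_const card_ord mulr_natl.
Qed.

Lemma sqn_coord_le (R : realType) n (x : 'rV[R]_n) d :
  (forall i, `|x 0 i| <= d) -> sqn x <= n%:R * d ^+ 2.
Proof.
move=> xd; rewrite (le_trans (ler_sum _ (G := fun=> d ^+ 2) _))//.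
  move=> i _; rewrite -[leLHS]ger0_norm ?sqr_ge0// normrX.
  by rewrite lerXn2r ?nnegrE// (le_trans _ (xd i)).
by rewrite sumr_const card_ord mulr_natl.
Qed.

(** The constant is crude; what matters is that it is uniform over a bounded
    set of matrices. *)
Lemma sqn_mulmx_le (R : realType) n (B : R) (x : 'rV[R]_n) (g : 'M[R]_n) :
  (forall i k, `|g i k| <= B) ->
  sqn (x *m g) <= n%:R ^+ 3 * B ^+ 2 * sqn x.
Proof.
move=> gB; have xd i : `|x 0 i| <= Num.sqrt (sqn x).
  by rewrite -sqrtr_sqr ler_wsqrtr// coord_le_sqn.
apply: (le_trans (sqn_coord_le (fun j => coord_mulmx_le j gB xd))).
rewrite 2!exprMn sqr_sqrtr ?sqn_ge0// le_eqVlt; apply/orP; left; apply/eqP.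
by rewrite exprSr; ring.
Qed.

Lemma continuous_bigsum (R : realType) (T : topologicalType) n
    (f : 'I_n -> T -> R) :
  (forall i, continuous (f i)) -> continuous (fun x => \sum_i f i x).
Proof.
move=> cf x.
have -> : (fun x => \sum_i f i x) = \sum_i f i.
  by apply/funext => y; rewrite fct_sumE.
elim/big_ind: _ => [|u v cu cv|i _]; [exact: cst_continuous| |exact: cf].
by apply: continuousD.
Qed.

Lemma mulmx_coord_continuous (R : realType) n m (g : 'M[R]_(n, m)) j :
  continuous (fun x : 'rV[R]_n => (x *m g) 0 j).
Proof.
have -> : (fun x : 'rV[R]_n => (x *m g) 0 j) = (fun x => \sum_i x 0 i * g i j).
  by apply/funext => x; rewrite mxE.
apply: continuous_bigsum => i x.
apply: continuousM; first exact: coord_continuous.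
exact: cst_continuous.
Qed.

Lemma sqn_mulmx_continuous (R : realType) n (g : 'M[R]_n) :
  continuous (fun x : 'rV[R]_n => sqn (x *m g)).
Proof.
apply: continuous_bigsum => i x.
by apply: continuousM; exact: mulmx_coord_continuous.
Qed.

(** Matrices act on row vectors from the right, so they stand for the group with
    the opposite multiplication.  The size [nm] of the entries is a parameter in
    order to treat real and complex matrices alike. *)
Record bounded_matrix_group (K : fieldType) (R : realType) (nm : K -> R) n
    (A : set 'M[K]_n) : Prop := {
  bmg1 : A 1%:M;
  bmgM : forall g h, A g -> A h -> A (g *m h);
  bmgV : forall g, A g -> exists2 h, A h & g *m h = 1%:M;
  bmg_bounded : exists B, forall g, A g -> forall i j, nm (g i j) <= B }.

(** If c is not 0, the function sup_g |x g|^2 has a unique minimum point on the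
    hyperplane x c = 1.  It exists by compactness of its sublevel sets.  Were
    there two, p and y, the parallelogram law applied to some g that nearly
    attains the supremum at their midpoint would make (p - y) g small, hence
    p - y small, since the inverse of g is bounded as well.  Uniqueness makes the
    minimum point fixed by the group, contradicting x c = 1. *)
Lemma real_invariant_functional_eq0 (R : realType) n (A : set 'M[R]_n)
    (c : 'cV[R]_n) :
  bounded_matrix_group Num.norm A -> (forall g, A g -> g *m c = c) ->
  (forall x : 'rV_n, (forall g, A g -> x *m g = x) -> x *m c = 0) -> c = 0.
Proof.
case=> A1 AM AV [B AB] Ac fixc; apply: contrapT => /eqP c0.
have {c0} [i0 ci0] : exists i, c i 0 != 0.
  by apply: contrapT => /forallNP cz; case/eqP: c0; apply/colP => i;
    rewrite mxE; apply/eqP/negPn/negP; exact: cz.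
pose ev (x : 'rV[R]_n) := (x *m c) 0 0.
(* S consists of the upper bounds of sup_g |x g|^2 over the points x of the
   hyperplane, so its infimum is that of the suprema. *)
pose S := [set e | exists x, ev x = 1 /\ forall g, A g -> sqn (x *m g) <= e].
pose x0 := (c i0 0)^-1 *: delta_mx 0 i0 : 'rV[R]_n.
have ev0 : ev x0 = 1.
  rewrite /ev -scalemxAl mxE -rowE mxE mulVf//.
have S0 : S !=set0.
  exists (n%:R ^+ 3 * B ^+ 2 * sqn x0), x0; split => // g Ag.
  by apply: sqn_mulmx_le => i j; exact: AB.
have lS : lbound S 0.
  by move=> e [x [_ /(_ _ A1)]]; apply: le_trans; exact: sqn_ge0.
have iS : has_inf S by split => //; exists 0.
pose m := inf S.
pose K e := [set x | ev x = 1 /\ forall g, A g -> sqn (x *m g) <= m + e].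
have K0 e : 0 < e -> K e !=set0.
  move=> e0; have [d [x [x1 xd]] de] := inf_adherent e0 iS.
  by exists x; split => // g Ag; rewrite (le_trans (xd _ Ag))// ltW.
have Kle d e : d <= e -> K d `<=` K e.
  by move=> de x [x1 xd]; split => // g Ag; rewrite (le_trans (xd _ Ag))// lerD2l.
have Kcl e : closed (K e).
  have -> : K e = (ev @^-1` [set 1]) `&`
      \bigcap_(g in A) ((fun x => sqn (x *m g)) @^-1` [set y | y <= m + e]).
    by apply/seteqP; split => x [? h]; split.
  apply: closedI.
    apply: preimage_closed => [x _|]; last exact: closed_eq.
    exact: mulmx_coord_continuous.
  apply: closed_bigI => g Ag.
  apply: preimage_closed => [x _|]; last exact: closed_le.
  exact: sqn_mulmx_continuous.
have Kco : compact (K 1).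
  apply: bounded_closed_compact; last exact: Kcl.
  exists (m + 1 + 1); split; first exact: num_real.
  move=> M mM x [_ /(_ _ A1)]; rewrite mulmx1 => xm.
  have m0 : 0 <= m + 1 by apply: le_trans xm; exact: sqn_ge0.
  rewrite /= [Num.norm x]mx_normrE; apply/bigmax_leP; split; first by lra.
  move=> [i j] _ /=; rewrite ord1.
  have := le_trans (coord_le_sqn x j) xm.
  rewrite -real_normK ?num_real//; set a := `|_| => am.
  have a0 : 0 <= a by rewrite normr_ge0.
  by nra.
(* A cluster point of the sublevel sets K e, as e tends to 0, minimises. *)
pose F : set_system 'rV[R]_n := filter_from [set e : R | 0 < e] K.
have PF : ProperFilter F.
  apply: filter_from_proper; last exact: K0.
  apply: filter_from_filter; first by exists 1 => /=.
  move=> i j i0' j0'; exists (Num.min i j); first by rewrite /= lt_min i0'.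
  by move=> x Kx; split; apply: Kle Kx; rewrite ge_min lexx ?orbT.
have [p [_ clp]] : K 1 `&` cluster F !=set0.
  by apply: Kco; exists 1 => /=.
have Kp e : 0 < e -> K e p.
  move=> e0; apply: Kcl => U pU; apply: clp => //.
  by exists e.
have p1 : ev p = 1 by have [] := Kp _ ltr01.
have pm g : A g -> sqn (p *m g) <= m.
  move=> Ag; apply/ler_addgt0Pr => e e0.
  by have [_] := Kp _ e0; apply.
have uniq y : ev y = 1 -> (forall g, A g -> sqn (y *m g) <= m) -> p = y.
  move=> y1 ym.
  pose z := 2%:R^-1 *: (p + y).
  have z1 : ev z = 1.
    by rewrite /ev -scalemxAl mulmxDl 2!mxE -/(ev p) -/(ev y) p1 y1; field.
  pose w := 2%:R^-1 *: (p - y).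
  suff : w = 0.
    move=> /eqP; rewrite scaler_eq0 invr_eq0 pnatr_eq0/= subr_eq0.
    by move=> /eqP.
  apply: sqn_eq0; apply/ler_addgt0Pr => e e0; rewrite add0r.
  pose C := n%:R ^+ 3 * B ^+ 2.
  have C0 : 0 <= C by rewrite mulr_ge0// ?sqr_ge0// exprn_ge0.
  have d0 : 0 < e / (C + 1) by rewrite divr_gt0// ltr_wpDl.
  (* The midpoint z lies on the hyperplane, so some |z g|^2 nearly reaches m. *)
  have [g Ag zg] : exists2 g, A g & m - e / (C + 1) < sqn (z *m g).
    apply: contrapT => h.
    have : S (m - e / (C + 1)).
      exists z; split => // g Ag; rewrite leNgt; apply/negP => zg.
      by apply: h; exists g.
    move=> /(ge_inf (ex_intro _ 0 lS)); rewrite -/m; lra.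
  have [h Ah gh] := AV _ Ag.
  have wg : sqn (w *m g) <= e / (C + 1).
    have := sqn_parallelogram (p *m g) (y *m g).
    rewrite -mulmxBl -mulmxDl !scalemxAl -/w -/z => ->.
    have := pm _ Ag; have := ym _ Ag; lra.
  rewrite -[w]mulmx1 -gh mulmxA (le_trans (sqn_mulmx_le _ (AB _ Ah)))// -/C.
  rewrite (le_trans (ler_wpM2l C0 wg))// mulrCA ler_piMr ?(ltW e0)//.
  by rewrite ler_pdivrMr ?ltr_wpDl// mul1r lerDl.
suff /fixc pc : forall g, A g -> p *m g = p.
  by move: p1; rewrite /ev pc mxE => /eqP; rewrite eq_sym oner_eq0.
move=> g Ag; apply/esym/uniq.
  by rewrite /ev -mulmxA Ac.
by move=> h Ah; rewrite -mulmxA; apply: pm; exact: AM.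
Qed.

(** * Invariant functionals of bounded complex matrix groups *)

Local Notation mxRe := (map_mx (@complex.Re _)).
Local Notation mxIm := (map_mx (@complex.Im _)).

(** The complex row vector a + i b is read as the real row vector (a, b). *)
Definition realify_mx (R : realType) n (g : 'M[complex R]_n) : 'M[R]_(n + n) :=
  block_mx (mxRe g) (mxIm g)
           (- mxIm g) (mxRe g).

Definition norm1c (R : realType) (z : complex R) : R :=
  `|complex.Re z| + `|complex.Im z|.

Lemma map_Re_mulmx (R : realType) m n p (g : 'M[complex R]_(m, n))
    (h : 'M[complex R]_(n, p)) :
  mxRe (g *m h) = mxRe g *m mxRe h -
    mxIm g *m mxIm h.
Proof.
apply/matrixP => i j; rewrite !mxE.
rewrite (big_morph (@complex.Re R) (id1 := 0) (op1 := +%R))//;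
  last by case=> ? ? [].
by rewrite -sumrB; apply: eq_bigr => k _; rewrite !mxE;
  case: (g i k) (h k j) => [? ?] [].
Qed.

Lemma map_Im_mulmx (R : realType) m n p (g : 'M[complex R]_(m, n))
    (h : 'M[complex R]_(n, p)) :
  mxIm (g *m h) = mxRe g *m mxIm h +
    mxIm g *m mxRe h.
Proof.
apply/matrixP => i j; rewrite !mxE.
rewrite (big_morph (@complex.Im R) (id1 := 0) (op1 := +%R))//;
  last by case=> ? ? [].
by rewrite -big_split; apply: eq_bigr => k _; rewrite !mxE;
  case: (g i k) (h k j) => [? ?] [].
Qed.

Lemma map_ReIm_inj (R : realType) m n (g h : 'M[complex R]_(m, n)) :
  mxRe g = mxRe h -> mxIm g = mxIm h ->
  g = h.
Proof.
move=> /matrixP re /matrixP im; apply/matrixP => i j.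
have := re i j; have := im i j; rewrite !mxE.
by case: (g i j) (h i j) => [? ?] [? ?] /= -> ->.
Qed.

Lemma realify_mxM (R : realType) n (g h : 'M[complex R]_n) :
  realify_mx (g *m h) = realify_mx g *m realify_mx h.
Proof.
rewrite /realify_mx mulmx_block map_Re_mulmx map_Im_mulmx.
rewrite !mulmxN !mulNmx; congr block_mx; first by rewrite opprD addrC.
by rewrite addrC.
Qed.

Lemma realify_mx1 (R : realType) n : realify_mx (1%:M : 'M[complex R]_n) = 1%:M.
Proof.
have E : mxRe 1%:M = 1%:M :> 'M[R]_n.
  by apply/matrixP => i j; rewrite !mxE; case: eqP.
have Z : mxIm 1%:M = 0 :> 'M[R]_n.
  by apply/matrixP => i j; rewrite !mxE; case: eqP.
by rewrite /realify_mx E Z oppr0 -scalar_mx_block.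
Qed.

(** The real part of the functional is a real functional invariant under the
    realified group, and it determines the functional: its coefficients are the
    real parts and the opposites of the imaginary parts of c. *)
Lemma invariant_functional_eq0 (R : realType) n (A : set 'M[complex R]_n)
    (c : 'cV[complex R]_n) :
  bounded_matrix_group (@norm1c R) A -> (forall g, A g -> g *m c = c) ->
  (forall x : 'rV_n, (forall g, A g -> x *m g = x) -> x *m c = 0) -> c = 0.
Proof.
case=> A1 AM AV [B AB] Ac fixc.
pose d : 'cV[R]_(n + n) := col_mx (mxRe c) (- mxIm c).
suff : d = 0.
  rewrite -[0]col_mx0 => /eq_col_mx[c1 /eqP]; rewrite oppr_eq0 => /eqP c2.
  apply: map_ReIm_inj; first by rewrite c1; apply/matrixP => ? ?; rewrite !mxE.
  by rewrite c2; apply/matrixP => ? ?; rewrite !mxE.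
apply: (@real_invariant_functional_eq0 _ _ [set realify_mx g | g in A]).
- split.
  + by exists 1%:M => //; exact: realify_mx1.
  + move=> _ _ [g Ag <-] [h Ah <-]; exists (g *m h); first exact: AM.
    exact: realify_mxM.
  + move=> _ [g Ag <-]; have [h Ah gh] := AV _ Ag.
    by exists (realify_mx h); [exists h|rewrite -realify_mxM gh realify_mx1].
  + exists B => _ [g Ag <-] i j; rewrite /realify_mx.
    rewrite !mxE; case: splitP => i' _; rewrite !mxE; case: splitP => j' _;
      rewrite !mxE ?normrN; apply: le_trans (AB _ Ag i' j');
      by rewrite /norm1c ?lerDl ?lerDr ?normr_ge0.
- move=> _ [g Ag <-]; rewrite /realify_mx /d mul_block_col -[in RHS](Ac g)//.
  rewrite map_Re_mulmx map_Im_mulmx !mulmxN !mulNmx; congr col_mx.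
  by rewrite opprD addrC.
- move=> x xA; pose a := lsubmx x; pose b := rsubmx x.
  pose z : 'rV[complex R]_n := \row_i complex.Complex (a 0 i) (b 0 i).
  have rez : mxRe z = a by apply/rowP => i; rewrite !mxE.
  have imz : mxIm z = b by apply/rowP => i; rewrite !mxE.
  have xab : x = row_mx a b by rewrite hsubmxK.
  have zA g : A g -> z *m g = z.
    move=> Ag; have := xA (realify_mx g) (ex_intro2 _ _ g Ag erefl).
    rewrite xab /realify_mx mul_row_block => /eq_row_mx[e1 e2].
    apply: map_ReIm_inj.
      by rewrite map_Re_mulmx rez imz -[RHS]e1 mulmxN.
    by rewrite map_Im_mulmx rez imz -[RHS]e2.
  have := fixc z zA; move=> /(congr1 (mxRe)).
  rewrite map_Re_mulmx rez imz xab /d mul_row_col mulmxN => ->.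
  by apply/matrixP => ? ?; rewrite !mxE.
Qed.

(** * Invariant functionals of compact group actions *)

(** In coordinates the action of g is right multiplication by a matrix A g, and
    A(gh) = A(h) A(g): the order is reversed. *)
Lemma bounded_action_invariant_eq0 (R : realType) (G : groupType)
    (W : lmodType (complex R)) (U : set W) n (b : 'I_n -> W)
    (rho : G -> W -> W) (phi : W -> complex R) :
  lin_subspace U -> is_basis U b -> linear_action rho ->
  (forall g v, U v -> U (rho g v)) ->
  (exists B, forall g i j, norm1c (coordf b (rho g (b i)) 0 j) <= B) ->
  (forall a u v, U u -> U v -> phi (a *: u + v) = a * phi u + phi v) ->
  (forall g v, U v -> phi (rho g v) = phi v) ->
  (forall v, U v -> (forall g, rho g v = v) -> phi v = 0) ->
  forall v, U v -> phi v = 0.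
Proof.
move=> sU Ub [rl r1 rM] rU [B rB] phiP phirho phi0.
have U0 := subsp0 sU.
have phi00 : phi 0 = 0.
  by have := phiP (- 1) 0 0 U0 U0; rewrite scaler0 addr0 mulN1r addNr.
pose A g : 'M[complex R]_n := \matrix_(i, j) coordf b (rho g (b i)) 0 j.
pose c : 'cV[complex R]_n := \col_i phi (b i).
pose vec (x : 'rV[complex R]_n) := \sum_i x 0 i *: b i.
have Uvec x : U (vec x) by exact: basis_sum.
have vecK x : coordf b (vec x) = x by exact: (coordf_eq sU Ub).
have rvec g x : rho g (vec x) = vec (x *m A g).
  rewrite /vec (lin_sum (rl g)).
  under eq_bigr => i _.
    rewrite (linZ (rl g)) {1}(coordfE Ub (rU g _ (Ub.1 i))) scaler_sumr; over.
  rewrite exchange_big; apply: eq_bigr => j _ /=.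
  rewrite mxE scaler_suml; apply: eq_bigr => i _.
  by rewrite mxE scalerA.
have phivec x : phi (vec x) = (x *m c) 0 0.
  rewrite mxE /vec; pose P u t := U u /\ phi u = t.
  suff [] : P (\sum_i x 0 i *: b i) (\sum_i x 0 i * c i 0) by [].
  elim/big_rec2: _ => [//|i t u _ [Uu <-]]; split.
    by case: sU => _; apply => //; exact: Ub.1.
  by rewrite phiP ?mxE//; exact: Ub.1.
have vec_inj : injective vec by exact: can_inj vecK.
have AM g h : A h *m A g = A (g * h)%g.
  apply/row_matrixP => i; rewrite !rowE mulmxA; apply: vec_inj.
  by rewrite -!rvec rM.
have A1 : A 1%g = 1%:M.
  by apply/row_matrixP => i; rewrite !rowE; apply: vec_inj;
    rewrite -rvec r1 mulmx1.
have c0 : c = 0.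
  apply: (@invariant_functional_eq0 _ _ (range A)).
  - split.
    + by exists 1%g.
    + by move=> _ _ [g _ <-] [h _ <-]; exists (h * g)%g; rewrite // AM.
    + by move=> _ [g _ <-]; exists (A g^-1%g); [exists g^-1%g|rewrite AM mulVg].
    + by exists B => _ [g _ <-] i j; rewrite mxE.
  - move=> _ [g _ <-]; apply/row_matrixP => i; rewrite !rowE mulmxA.
    apply/matrixP => x y; rewrite !ord1 -!phivec.
    by rewrite -rvec phirho.
  - move=> x xA; apply/matrixP => i j; rewrite !ord1 -phivec mxE phi0// => g.
    by rewrite rvec xA//; exists g.
move=> v Uv; rewrite (coordfE Ub Uv) -/(vec _) phivec c0 mulmx0.
by rewrite mxE.
Qed.

(** Continuity is known for matrix coefficients of functionals on all of W; the
    projection p onto U extends the coordinate functionals of U to W.  By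
    compactness the matrix entries are then bounded. *)
Lemma compact_action_invariant_eq0 (R : realType) (G : topologicalGroupType)
    (W : lmodType (complex R)) (U : set W) (p : W -> W)
    (rho : G -> W -> W) (phi : W -> complex R) :
  compact [set: G] -> lin_subspace U -> finite_dim U ->
  linear p -> (forall v, U (p v)) -> (forall v, U v -> p v = v) ->
  linear_action rho -> continuous_action rho ->
  (forall g v, U v -> U (rho g v)) ->
  (forall a u v, U u -> U v -> phi (a *: u + v) = a * phi u + phi v) ->
  (forall g v, U v -> phi (rho g v) = phi v) ->
  (forall v, U v -> (forall g, rho g v = v) -> phi v = 0) ->
  forall v, U v -> phi v = 0.
Proof.
move=> Gco sU [n [b Ub]] lp pU pid actG ctsG rU.
apply: (bounded_action_invariant_eq0 sU Ub) => //.
have bnd i j : exists B, forall g, norm1c (coordf b (rho g (b i)) 0 j) <= B.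
  pose l (v : W) : complex R := coordf b (p v) 0 j.
  have ll : scalar l by move=> a u v; rewrite /l lp (coordfP sU Ub)// !mxE.
  pose L : {scalar W} :=
    HB.pack_for {scalar W} l (GRing.isLinear.Build _ _ _ _ l ll).
  have [cRe cIm] := ctsG L (b i).
  have cbnd (f : G -> R) : continuous f -> exists B, forall g, `|f g| <= B.
    move=> cf; have : bounded_set (f @` [set: G]).
      apply: compact_bounded; apply: continuous_compact => //.
      exact: continuous_subspaceT.
    by case=> M [_ /(_ (M + 1))]; rewrite ltrDl ltr01 => /(_ isT) h;
      exists (M + 1) => g; apply: h; exists g.
  have [B1 h1] := cbnd _ cRe; have [B2 h2] := cbnd _ cIm.
  exists (B1 + B2) => g; apply: lerD.
    by have := h1 g; rewrite /L/= /l pid//; apply: rU; exact: Ub.1.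
  by have := h2 g; rewrite /L/= /l pid//; apply: rU; exact: Ub.1.
have {bnd} bnd i j : {B | forall g, norm1c (coordf b (rho g (b i)) 0 j) <= B}.
  exact: cid.
exists (\sum_i \sum_j `|sval (bnd i j)|) => g i j.
apply: (le_trans (svalP (bnd i j) g)); apply: (le_trans (ler_norm _)).
rewrite (bigD1 i)//= (bigD1 j)//= -addrA lerDl.
by rewrite addr_ge0// sumr_ge0// => k _; rewrite sumr_ge0.
Qed.

(** * Commutators of the Virasoro modes with modes of other vectors *)

Section Modes.
Context {R : realType} {V : voa R}.
Local Notation C := (complex R).
Local Notation Y := (vertex_op V).
Local Notation vac := (vacuum V).

Lemma binz0 (F : fieldType) m : binz F m 0 = 1.
Proof. by rewrite /binz big_ord0 fact0 divr1. Qed.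

Lemma binz_small (F : fieldType) (m j : nat) : (m < j)%N -> binz F m%:Z j = 0.
Proof.
by move=> mj; rewrite /binz (bigD1 (Ordinal mj))//= subrr mul0r mul0r.
Qed.

Lemma binz11 (F : fieldType) : binz F 1 1 = 1.
Proof. by rewrite /binz big_ord_recl big_ord0/= subr0 mulr1 divr1. Qed.

(** These are the coefficients of (1 - x)^-2. *)
Lemma binzN2 j : (-1) ^+ j * binz C (- 2%:Z) j = j.+1%:R.
Proof.
rewrite /binz mulrA.
have -> : (-1) ^+ j * (\prod_(i < j) (- 2%:Z - i%:Z)%:~R : C) = j.+1`!%:R.
  elim: j => [|j IH]; first by rewrite big_ord0 mulr1.
  rewrite big_ord_recr/= exprS factS natrM -IH.
  have -> : ((- 2%:Z - j%:Z)%:~R : C) = - j.+2%:R by rewrite -opprD rmorphN.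
  by ring.
by rewrite factS natrM mulfK// pnatr_eq0 -lt0n fact_gt0.
Qed.

Lemma translation_vacuum v : L (-1) v = Y v (- 2%:Z) vac.
Proof.
have := voa_translation (voaP V) v (-1) vac.
by rewrite (voa_creation (voaP V)) opprK scale1r.
Qed.

Variable N : voa_module V.
Let axN := module_opP N.
Local Notation YN := (module_op N).

(** The derivation property is an axiom for V only.  On a module it follows from
    the Borcherds identity for v and the vacuum at m = 0, n = -2: every mode of
    the vacuum but the one of index -1 vanishes, so at most one term is left. *)
Lemma module_translation v (k : int) w :
  YN (L (-1) v) k w = - k%:~R *: YN v (k - 1) w.
Proof.
have := modes_borcherds axN 0 (- 2%:Z) k v vac w.
move=> /filterI/(_ (nbhs_infty_ge (`|k|%N.+2))) /filter_ex[M [/= + kM]].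
case: M kM => // M kM.
rewrite big_ord_recl big1 ?addr0; last first.
  by move=> i _; rewrite binz_small// scale0r.
rewrite binz0 scale1r /= add0r -translation_vacuum => ->.
under eq_bigr => j _.
  rewrite binzN2 !(modes_vacuum axN) !add0r.
  rewrite (_ : (-1) ^ (- 2%:Z) = 1) ?scale1r; last first.
    by rewrite -exprnN sqrrN expr1n invr1.
  over.
(* For k >= 0 only the terms with the vacuum in front count, at j = k - 1 if
   k > 0; for k = - (p + 1) only the others, at j = p. *)
case: k kM => p kM.
- under eq_bigr => j _.
    have -> : (p%:Z + j%:Z == -1) = false by apply/eqP; lia.
    rewrite (lin0 (modes_linearr axN _ _)) sub0r; over.
  case: p kM => [|p] kM.
    rewrite oppr0 scale0r big1// => j _.
    by rewrite ifF ?oppr0 ?scaler0//; case: (nat_of_ord j).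
  have pM : (p < M.+1)%N by rewrite (leq_trans _ kM)//= ltnS leqW.
  rewrite (bigD1 (Ordinal pM))//= big1 ?addr0.
    rewrite ifT ?add0r ?scalerN ?scaleNr; first by rewrite -addn1 PoszD addrK.
    by apply/eqP; lia.
  move=> j /eqP jp; rewrite ifF ?oppr0 ?scaler0//; apply/negP => /eqP e.
  by apply: jp; apply/val_inj => /=; lia.
- have pM : (p < M.+1)%N by rewrite (leq_trans _ kM)//= ltnS leqW.
  rewrite (bigD1 (Ordinal pM))//= big1 ?addr0.
    rewrite ifT; last by apply/eqP; lia.
    rewrite ifF ?subr0; last by apply/eqP; lia.
    rewrite NegzE rmorphN opprK; congr (_ *: YN v _ w); lia.
  move=> j /eqP jp; rewrite ifF; last first.
    apply/negP => /eqP e.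
    by apply: jp; apply/val_inj => /=; lia.
  rewrite ifF ?(lin0 (modes_linearr axN _ _)) ?subr0 ?scaler0//.
  by apply/negP => /eqP e; lia.
Qed.

(** The Borcherds identity for the conformal vector and v at m = 1, n = 0. *)
Lemma L0_mode_commutator v (k : int) w :
  virop YN (conformal_vector V) 0 (YN v k w) -
  YN v k (virop YN (conformal_vector V) 0 w) =
  YN (L (-1) v) (1 + k) w + YN (L 0 v) k w.
Proof.
have := modes_borcherds axN 1 0 k (conformal_vector V) v w.
move=> /filterI/(_ (nbhs_infty_ge 2)) /filter_ex[[|[|M]] [/= + kM]] //.
rewrite [LHS]big_ord_recl [X in _ + X]big_ord_recl big1 ?addr0; last first.
  by move=> i _; rewrite binz_small// scale0r.
rewrite big_ord_recl [X in _ = _ + X]big1 ?addr0; last first.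
  by move=> i _; rewrite binz_small// mulr0 scale0r.
rewrite !binz0 binz11 !scale1r /= mulr1 scale1r (add0r k) => E.
apply: etrans (esym E) _.
by congr (_ + YN _ _ w); rewrite addrAC subrr add0r.
Qed.

End Modes.

(** * Degrees in highest weight modules *)

(** For v of degree n the two terms of the commutator of L_0 with the mode of
    index n - 1 cancel. *)
Lemma zero_mode_homog (R : realType) (V : voa R) (N : voa_module V) n v h w :
  homog V n v -> module_homog N h w ->
  module_homog N h (module_op N v (n%:Z - 1) w).
Proof.
move=> vn wh; have := L0_mode_commutator v (n%:Z - 1) w.
rewrite (addrC 1) subrK module_translation (vn : L 0 v = _).
rewrite (linZ (modes_linearl (module_opP N) _ _) n%:R v) scaleNr addNr => /eqP.
rewrite subr_eq0 => /eqP E; apply: etrans E _.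
by rewrite (wh : virop _ _ 0 w = _) (linZ (modes_linearr (module_opP N) _ _)).
Qed.

Section Weights.
Context {R : realType} {V : voa R}.
Local Notation C := (complex R).

Lemma L_linear n : linear (L n : V -> V).
Proof. exact: (modes_linearr (voa_adjoint (voaP V))). Qed.

Lemma eigenspace_subspace (N : lmodType C) (f : N -> N) (h : C) :
  linear f -> lin_subspace [set w | f w = h *: w].
Proof.
move=> lf; split => [|a u v /= fu fv]; first by rewrite /= (lin0 lf) scaler0.
by rewrite lf fu fv scalerDr !scalerA mulrC.
Qed.

Lemma homog_subspace n : lin_subspace (homog V n).
Proof. exact: eigenspace_subspace (L_linear 0). Qed.

Lemma module_homog_subspace (N : voa_module V) h :
  lin_subspace (module_homog N h).
Proof. exact: eigenspace_subspace (modes_linearr (module_opP N) _ _). Qed.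

Definition L0_prod (s : seq nat) (x : V) : V :=
  foldr (fun k y => L 0 y - k%:R *: y) x s.

Lemma L0_prod_linear s : linear (L0_prod s).
Proof.
elim: s => [//|k s IH] a u v /=.
rewrite IH (L_linear 0) scalerDr scalerBr opprD addrACA.
by rewrite !scalerA mulrC.
Qed.

Lemma L0_prod_stable (U : set V) s x : lin_subspace U ->
  (forall y, U y -> U (L 0 y)) -> U x -> U (L0_prod s x).
Proof.
move=> sU UL Ux; elim: s => [//|k s IH] /=.
by apply: subspB => //; [exact: UL|exact: subspZ].
Qed.

Lemma L0_prodL s x : L0_prod s (L 0 x) = L 0 (L0_prod s x).
Proof.
elim: s => [//|k s IH] /=.
by rewrite IH (linB (L_linear 0)) (linZ (L_linear 0)).
Qed.

Lemma L0_prodC s s' x : L0_prod s (L0_prod s' x) = L0_prod s' (L0_prod s x).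
Proof.
elim: s => [//|k s IH] /=.
by rewrite IH (linB (L0_prod_linear s')) (linZ (L0_prod_linear s')) L0_prodL.
Qed.

Lemma L0_prod_cat s s' x : L0_prod (s ++ s') x = L0_prod s (L0_prod s' x).
Proof. by rewrite /L0_prod foldr_cat. Qed.

Lemma L0_prod_homog s n x : homog V n x ->
  L0_prod s x = (\prod_(k <- s) (n%:R - k%:R)) *: x.
Proof.
move=> xn; elim: s => [|k s IH] /=; first by rewrite big_nil scale1r.
rewrite IH (linZ (L_linear 0)) (xn : L 0 x = _) big_cons !scalerA -scalerBl.
by rewrite mulrBl [_ * n%:R]mulrC.
Qed.

Lemma L0_prod_homog_neq0 s n : n \notin s ->
  \prod_(k <- s) (n%:R - k%:R) != 0 :> C.
Proof.
move=> ns; rewrite prodf_seq_neq0; apply/allP => k ks /=.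
by rewrite subr_eq0 eqr_nat; apply: contraNneq ns => ->.
Qed.

(** The sums of homogeneous vectors with degrees in P, described by an
    annihilating product of factors L_0 - k rather than by components: closure
    properties then need no splitting into homogeneous parts. *)
Definition weights_in (P : pred nat) : set V :=
  [set x | exists2 s, all P s & L0_prod s x = 0].

Lemma weights_in_subspace P : lin_subspace (weights_in P).
Proof.
split; first by exists [::].
move=> a u v [s Ps su] [s' Ps' sv]; exists (s ++ s').
  by rewrite all_cat Ps.
rewrite (L0_prod_linear (s ++ s')) !L0_prod_cat sv (lin0 (L0_prod_linear s)).
by rewrite L0_prodC su (lin0 (L0_prod_linear s')) scaler0 addr0.
Qed.

Lemma homog_weights_in (P : pred nat) k x : P k -> homog V k x -> weights_in P x.
Proof.
move=> Pk xk; exists [:: k]; first by rewrite /= Pk.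
by rewrite /= (xk : L 0 x = _) subrr.
Qed.

(** The product that annihilates x - y multiplies x by a nonzero scalar and maps
    y into U. *)
Lemma weights_in_homog_mem (P : pred nat) (U : set V) n x y : ~~ P n ->
  lin_subspace U -> (forall y, U y -> U (L 0 y)) ->
  homog V n x -> U y -> weights_in P (x - y) -> U x.
Proof.
move=> Pn sU UL xn Uy [s Ps].
rewrite (linB (L0_prod_linear s)) => /eqP; rewrite subr_eq0 => /eqP.
rewrite (L0_prod_homog s xn).
have c0 : \prod_(k <- s) (n%:R - k%:R) != 0 :> C.
  by apply: L0_prod_homog_neq0; apply: contraNN Pn => /(allP Ps).
move=> /(congr1 ( *:%R (\prod_(k <- s) (n%:R - k%:R))^-1)).
rewrite scalerA mulVf// scale1r => ->.
by apply: subspZ => //; exact: L0_prod_stable.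
Qed.

(** The complement of V_n is the sum of the other degrees. *)
Lemma homog_projection n : exists p : V -> V,
  [/\ linear p, forall v, homog V n (p v) & forall v, homog V n v -> p v = v].
Proof.
have sE := weights_in_subspace (predC1 n).
apply: (exists_projection (homog_subspace n) sE).
  move=> v vn vE; apply: (weights_in_homog_mem
    (P := predC1 n) (U := [set 0]) (y := 0) _ _ _ vn).
  - by rewrite /= eqxx.
  - by split => // a u w -> ->; rewrite scaler0 addr0.
  - by move=> y ->; exact: (lin0 (L_linear 0)).
  - by [].
  - by rewrite subr0.
move=> v; have : [set: V] v by [].
rewrite (voa_grading (voaP V)).1 => -[s [w [wh ->]]].
elim: s => [|i s [a an aE]].
  exists 0; first exact: subsp0 (homog_subspace n).
  by rewrite big_nil subrr; exact: subsp0 sE.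
rewrite big_cons; have [ni|ni] := eqVneq i n.
  exists (w i + a); last by rewrite opprD addrACA subrr add0r.
  by apply: (subspD (homog_subspace n)) an; rewrite -ni; exact: wh.
exists a => //; rewrite -addrA; apply: (subspD sE) aE.
exact: homog_weights_in (wh i).
Qed.

Lemma lowering_weights_in h m x : weights_in (leq h) x ->
  weights_in (leq h) (L (- m%:Z) x).
Proof.
move=> [s hs sx]; exists (map (addn m) s).
  rewrite all_map; apply: sub_all hs => k /=.
  by move=> hk; rewrite (leq_trans hk)// leq_addl.
suff -> y : L0_prod (map (addn m) s) (L (- m%:Z) y) = L (- m%:Z) (L0_prod s y).
  by rewrite sx (lin0 (L_linear _)).
elim: s {hs sx} => [//|k s IH] /=; rewrite IH.
set z := L0_prod s y.
have := voa_virasoro (voaP V) 0 (- m%:Z) z.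
rewrite -/(L 0) -/(L (- m%:Z)) -/(L (0 + - m%:Z)) expr0n/= subrr mul0r mul0r.
rewrite scale0r if_same addr0 !add0r opprK => /eqP; rewrite subr_eq => /eqP E.
rewrite (linB (L_linear _)) (linZ (L_linear _)) -/L.
have -> : L 0 (L (- m%:Z) z) = m%:R *: L (- m%:Z) z + L (- m%:Z) (L 0 z).
  exact: E.
by rewrite natrD scalerDl opprD addrACA subrr add0r.
Qed.

(** The span P of the vectors obtained from the highest weight vector u by the
    operators L_(-n), n > 0, is already a Virasoro submodule: moving L_m with
    m >= 0 past L_(-n) only creates L_(m - n) and a scalar.  Lowering operators
    add to the degree, so P lives in degrees at least h. *)
Lemma hw_module_weights_in h (W : set V) : hw_module h W ->
  W `<=` weights_in (leq h).
Proof.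
case=> u [_ u0 un ->].
pose closedL (U : set V) := lin_subspace U /\
  forall (n : nat) x, U x -> U (L (- n.+1%:Z) x).
pose P : set V := [set x | forall U, closedL U -> U u -> U x].
have sP : lin_subspace P.
  split => [U [sU _] _|a x y Px Py U cU Uu]; first exact: subsp0 sU.
  by case: (cU) => -[_ US] _; apply: US; [exact: Px|exact: Py].
have PL (n : nat) x : P x -> P (L (- n.+1%:Z) x).
  by move=> Px U cU Uu; apply: cU.2; exact: Px.
have Pu : P u by [].
(* The conjunction, not its second half alone, is what L_(-n) preserves. *)
have PQ x : P x -> P x /\ forall m : nat, P (L m%:Z x).
  move=> Px; apply: (Px [set y | P y /\ forall m : nat, P (L m%:Z y)]) => /=.
    split.
      split => [|a y z [Py Qy] [Pz Qz]].
        by split => [|m]; [exact: subsp0|];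
          rewrite ?(lin0 (L_linear _)); exact: subsp0.
      split; first by case: sP => _; apply.
      by move=> m; rewrite L_linear; case: sP => _; apply.
    move=> n y [Py Qy]; split; first exact: PL.
    move=> m; have := voa_virasoro (voaP V) m%:Z (- n.+1%:Z) y.
    move=> /eqP; rewrite subr_eq => /eqP E.
    refine (eq_ind_r P _ E).
    apply: (subspD sP); last by apply: PL; exact: Qy.
    apply: (subspD sP); last first.
      by case: ifP => _; [exact: (subspZ sP)|exact: subsp0 sP].
    apply: (subspZ sP).
    case: (leqP n.+1 m) => mn; first by rewrite subzn//; exact: Qy.
    have -> : m%:Z + - n.+1%:Z = - (n - m).+1%:Z by lia.
    exact: PL.
  split => //; case=> [|m]; last by rewrite un; exact: subsp0 sP.
  by rewrite u0; exact: (subspZ sP).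
apply: (@subset_trans _ P).
  apply: smallest_sub; last by move=> _ ->.
  split => // -[m|m] x Px; first by have [_] := PQ _ Px.
  by rewrite NegzE; exact: PL.
move=> x Px; apply: Px.
  split; first exact: weights_in_subspace.
  by move=> n y; exact: lowering_weights_in.
exact: (homog_weights_in (k := h)).
Qed.

Lemma V_omega_subalgebra : vertex_subalgebra (V_omega V).
Proof.
split.
- split => [U [[sU _ _] _]|a x y Ux Uy U cU]; first exact: subsp0.
  by case: (cU) => -[[_ US] _ _] _; apply: US; [exact: Ux|exact: Uy].
- by move=> U [[_ U1 _] _].
- move=> u n v Uu Uv U cU; case: (cU) => -[_ _ U2] _.
  by apply: U2; [exact: Uu|exact: Uv].
Qed.

Lemma V_omega_conformal : V_omega V (conformal_vector V).
Proof. by move=> U [_]; exact. Qed.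

Lemma V_omega_subspace : lin_subspace (V_omega V).
Proof. by case: V_omega_subalgebra. Qed.

Lemma V_omega_L n v : V_omega V v -> V_omega V (L n v).
Proof. by case: V_omega_subalgebra => _ _; apply; exact: V_omega_conformal. Qed.

(** A highest weight vector of weight 0 is a multiple of the vacuum. *)
Lemma hw_module0_V_omega (W : set V) : hw_module 0 W -> W `<=` V_omega V.
Proof.
case=> u [_ u0 _ ->]; apply: smallest_sub.
  by split; [exact: V_omega_subspace|move=> n v; exact: V_omega_L].
move=> _ ->.
have : eigenspace0 (vertex_op V) (conformal_vector V) 0 u by exact: u0.
rewrite (voa_degree0 (voaP V)) => -[a _ <-].
by apply: (subspZ V_omega_subspace); case: V_omega_subalgebra.
Qed.

(** Modulo vectors of degree > t, v equals the component of weight 0, which lies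
    in V_omega; V_omega is L_0-stable, so it contains the part of degree n. *)
Lemma hw_decomposition_low_degree t (U : set V) (M : nat -> set V) n v :
  hw_decomposition U M -> (forall h, (0 < h <= t)%N -> M h = [set 0]) ->
  (n <= t)%N -> U v -> homog V n v -> V_omega V v.
Proof.
move=> [[-> _] Mhw] M0 nt [s [w [wM ->]]] vn.
have sE := weights_in_subspace (leq t.+1).
have MW h (A : set V) : lin_subspace A ->
    (forall W, hw_module h W -> W `<=` A) -> M h `<=` A.
  move=> sA hA; have [k [W [hW [-> _]]]] := Mhw h.
  by move=> _ [r [f [fW ->]]]; apply: (subsp_sum sA) => i;
    apply: hA (hW i) _ (fW i).
have [a ao aE] : exists2 a, V_omega V a &
    weights_in (leq t.+1) (\sum_(i <- s) w i - a).
  elim: s {vn} => [|i s [a ao aE]].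
    exists 0; first exact: subsp0 V_omega_subspace.
    by rewrite big_nil subrr; exact: subsp0 sE.
  rewrite big_cons; have [i0|i0] := posnP i.
    exists (w i + a); last by rewrite opprD addrACA subrr add0r.
    apply: (subspD V_omega_subspace) ao.
    apply: (MW i) (wM i); first exact: V_omega_subspace.
    by rewrite i0; exact: hw_module0_V_omega.
  exists a => //; rewrite -addrA; apply: (subspD sE) aE.
  have [it|it] := leqP i t.
    by have := wM i; rewrite M0 ?i0// => ->; exact: subsp0 sE.
  apply: (MW i) (wM i) => // W /hw_module_weights_in iW x /iW[r ri rx].
  by exists r => //; apply: sub_all ri => j; exact: leq_trans.
apply: weights_in_homog_mem vn ao aE; first by rewrite -leqNgt.
  exact: V_omega_subspace.
exact: V_omega_L.
Qed.

End Weights.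

(** * Automorphisms, vacuum projections and traces of zero modes *)

Section Transport.
Context {R : realType} {V : voa R}.

Lemma vir_submodule_smallest (S : set V) :
  vir_submodule (smallest (@vir_submodule R V) S).
Proof.
split; last by move=> n v Uv U cU; case: (cU) => -[_ UL] _; apply: UL; exact: Uv.
split=> [U [[sU _] _]|a x y Ux Uy U cU]; first exact: subsp0.
by case: (cU) => -[[_ US] _] _; apply: US; [exact: Ux|exact: Uy].
Qed.

Lemma sum_of_stable (f : V -> V) (I : eqType) (W : I -> set V) v : linear f ->
  (forall i w, W i w -> W i (f w)) -> sum_of W v -> sum_of W (f v).
Proof.
move=> lf Wf [s [w [wW ->]]]; exists s, (f \o w); split => [i|].
  exact/Wf/wW.
exact: lin_sum.
Qed.

Lemma hw_decomposition_L U (M : nat -> set V) h n v :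
  hw_decomposition U M -> M h v -> M h (L n v).
Proof.
move=> [_ /(_ h)[k [W [hW [-> _]]]]]; apply: sum_of_stable.
  exact: L_linear.
move=> i w; case: (hW i) => u [_ _ _ ->].
by case: (vir_submodule_smallest [set u]) => _; apply.
Qed.

(** The image and the kernel of pi are both stable under L_0, so pi commutes
    with L_0. *)
Lemma vacuum_projection_homog (pi : V -> V) n v :
  vacuum_projection V pi -> homog V n v -> homog V n (pi v).
Proof.
case=> M [dM lpi piO pid kerpi] vn.
have kL x : pi x = 0 -> pi (L 0 x) = 0.
  have -> : (pi x = 0) = hw_kernel M x by rewrite -kerpi.
  have -> : (pi (L 0 x) = 0) = hw_kernel M (L 0 x) by rewrite -kerpi.
  apply: sum_of_stable; first exact: L_linear.
  move=> i w; case: ifP => _; last exact: hw_decomposition_L dM.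
  by move=> ->; exact: (lin0 (L_linear 0)).
have piL x : pi (L 0 x) = L 0 (pi x).
  have : pi (L 0 (x - pi x)) = 0 by apply: kL;
    rewrite (linB lpi) (pid _ (piO x)) subrr.
  rewrite (linB (L_linear 0)) (linB lpi) => /eqP; rewrite subr_eq0 => /eqP ->.
  by apply: pid; exact: V_omega_L.
rewrite /homog /eigenspace0 /= -/(L 0 _).
by rewrite -piL (vn : L 0 v = _) (linZ lpi).
Qed.

Variables f f' : V -> V.
Hypotheses (lf : linear f) (lf' : linear f').
Hypotheses (fK : cancel f f') (f'K : cancel f' f).
Hypothesis fL : forall n v, f (L n v) = L n (f v).

Let f'L n v : f' (L n v) = L n (f' v).
Proof. by rewrite -{1}[v]f'K -fL fK. Qed.

Lemma image_sum_of (I : eqType) (W : I -> set V) :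
  f @` sum_of W = sum_of (fun i => f @` W i).
Proof.
apply/seteqP; split => [_ [_ [s [w [wW ->]]] <-]|v [s [w [wW ->]]]].
  exists s, (f \o w); split => [i|]; first by exists (w i).
  exact: lin_sum.
exists (\sum_(i <- s) f' (w i)).
  by exists s, (f' \o w); split => // i /=; have [x Wx <-] := wW i; rewrite fK.
by rewrite (lin_sum lf); apply: eq_bigr => i _; rewrite f'K.
Qed.

Lemma image_direct_sum (I : eqType) (W : I -> set V) (U : set V) :
  direct_sum W U -> direct_sum (fun i => f @` W i) (f @` U).
Proof.
move=> [-> dW]; split; first exact: image_sum_of.
move=> s w us wW sw0 i si; rewrite -[w i]f'K.
suff -> : f' (w i) = 0 by exact: lin0.
apply: (dW s (f' \o w)) => //.
  by move=> j /=; have [x Wx <-] := wW j; rewrite fK.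
by rewrite /= -(lin_sum lf') sw0 (lin0 lf').
Qed.

(** The generator f u has the weight of u, and images and preimages of Virasoro
    submodules under f are Virasoro submodules. *)
Lemma image_hw_module h (W : set V) : hw_module h W -> hw_module h (f @` W).
Proof.
move=> [u [u0 uh un ->]]; exists (f u); split.
- by apply: contra_neq u0 => fu0; rewrite -[u]fK fu0 (lin0 lf').
- by rewrite -fL uh (linZ lf).
- by move=> n; rewrite -fL un (lin0 lf).
- apply/seteqP; split.
    move=> _ [x xU <-]; move: x xU; apply: smallest_sub.
      have [sU UL] := vir_submodule_smallest [set f u].
      split; first exact: preimage_subspace.
      by move=> n x /= Ux; rewrite /preimage/= fL; exact: UL.
    by move=> _ -> U [_]; exact.
  apply: smallest_sub.
    have [sU UL] := vir_submodule_smallest [set u].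
    split; first exact: image_subspace.
    by move=> n _ [x Ux <-]; exists (L n x); [exact: UL|exact: fL].
  by move=> _ ->; exists u => // U [_]; exact.
Qed.

(** The conjugate projection belongs to the transported decomposition. *)
Lemma vacuum_projection_conj (pi : V -> V) :
  (forall v, V_omega V v -> f v = v) ->
  vacuum_projection V pi -> vacuum_projection V (f \o pi \o f').
Proof.
move=> fO [M [[dM hM] lpi piO pid kerpi]].
have f'O v : V_omega V v -> f' v = v by move=> Ov; rewrite -{1}[v]fO// fK.
exists (fun h => f @` M h); split.
- split => [|h].
    have -> : [set: V] = f @` [set: V].
      by apply/seteqP; split => // v _; exists (f' v).
    exact: image_direct_sum.
  have [k [W [hW dW]]] := hM h; exists k, (fun i => f @` W i); split.
    by move=> i; exact: image_hw_module.
  exact: image_direct_sum.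
- by move=> a u v /=; rewrite lf' lpi lf.
- by move=> v /=; rewrite fO.
- by move=> v Ov /=; rewrite f'O// pid// fO.
- have -> : hw_kernel (fun h => f @` M h) = f @` hw_kernel M.
    rewrite /hw_kernel image_sum_of; congr sum_of; apply/funext => h.
    by case: ifP => // _; rewrite image_set1 (lin0 lf).
  rewrite -kerpi; apply/seteqP; split => v /=.
    by move=> fv; exists (f' v) => //; rewrite -[LHS]fK fv (lin0 lf').
  by move=> [x px <-]; rewrite fK px (lin0 lf).
Qed.

End Transport.

Section Automorphisms.
Context {R : realType} {V : voa R} {G : groupType} {rho : G -> V -> V}.
Hypothesis autV : acts_by_automorphisms rho.

Lemma aut_L g n v : rho g (L n v) = L n (rho g v).
Proof.
by case: autV => _ rY _ ro; rewrite /L /virop rY ro.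
Qed.

Lemma aut_homog g n v : homog V n v -> homog V n (rho g v).
Proof.
move=> vn; rewrite /homog /eigenspace0 /= -/(L 0 _).
by case: autV => -[rl _ _] _ _ _; rewrite -aut_L (vn : L 0 v = _) (linZ (rl g)).
Qed.

Lemma aut_V_omega g v : V_omega V v -> rho g v = v.
Proof.
case: autV => -[rl _ _] rY rv ro; move: v.
apply: (@smallest_sub _ (@vertex_subalgebra R V) _ [set v | rho g v = v]).
  split => //=; last by move=> u n v uf vf; rewrite rY uf vf.
  split => [|a u v uf vf]; first exact: lin0 (rl g).
  by rewrite /= rl uf vf.
by move=> _ ->; exact: ro.
Qed.

(** By uniqueness pi commutes with rho g, which is the identity on V_omega. *)
Lemma vacuum_projection_aut (pi : V -> V) g v :
  unique (vacuum_projection V) pi -> pi (rho g v) = pi v.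
Proof.
move=> [vpi upi]; case: (autV) => -[rl r1 rM] _ _ _.
have rK h : cancel (rho h) (rho h^-1%g) by move=> w; rewrite -rM mulVg r1.
have rVK h : cancel (rho h^-1%g) (rho h) by move=> w; rewrite -rM mulgV r1.
have piE : pi = rho g \o pi \o rho g^-1%g.
  apply: upi; apply: vacuum_projection_conj => //.
    exact: aut_L.
  exact: aut_V_omega.
rewrite {1}piE /= rK; apply: aut_V_omega.
by case: vpi => M [_ _ + _ _]; apply.
Qed.

Variables (N : voa_module V) (h : complex R).
Local Notation X := (module_homog N h).

Lemma module_homog_finite_dim : finite_dim X.
Proof. exact: module_finite_dim. Qed.

Lemma trace_zero_mode_linear n a u v : homog V n u -> homog V n v ->
  trace_on X (module_op N (a *: u + v) (n%:Z - 1)) =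
  a * trace_on X (module_op N u (n%:Z - 1)) +
  trace_on X (module_op N v (n%:Z - 1)).
Proof.
move=> un vn; rewrite -trace_onP.
- congr trace_on; apply/funext => w.
  exact: (modes_linearl (module_opP N)).
- exact: module_homog_subspace.
- exact: module_homog_finite_dim.
- exact: (modes_linearr (module_opP N)).
- exact: (modes_linearr (module_opP N)).
- by move=> w; exact: zero_mode_homog.
- by move=> w; exact: zero_mode_homog.
Qed.

(** A lift of g to the central extension conjugates one zero mode into the
    other; it fixes the conformal vector, so it commutes with L_0 and preserves
    the homogeneous subspaces. *)
Lemma trace_zero_mode_aut n g v : G_invariant rho N -> homog V n v ->
  trace_on X (module_op N (rho g v) (n%:Z - 1)) =
  trace_on X (module_op N v (n%:Z - 1)).
Proof.
move=> [E [bar [sigma [barS _ [sl s1 sM] sY]]]] vn.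
have [x <-] := barS g.
have sK y : cancel (sigma y) (sigma y^-1%g) by move=> w; rewrite -sM mulVg s1.
have sVK y : cancel (sigma y^-1%g) (sigma y) by move=> w; rewrite -sM mulgV s1.
have sX y w : X w -> X (sigma y w).
  move=> wX; have : virop (module_op N) (conformal_vector V) 0 (sigma y w) =
      h *: sigma y w; last by [].
  have := sY y (conformal_vector V) 1 w.
  case: autV => _ _ _ ->.
  move=> /(congr1 (sigma y)); rewrite sVK => e; apply: etrans e _.
  by rewrite -(linZ (sl y)) -(wX : virop _ _ 0 w = _).
have -> : module_op N (rho (bar x) v) (n%:Z - 1) =
    (fun w => sigma x (module_op N v (n%:Z - 1) (sigma x^-1%g w))).
  by apply/funext => w; rewrite -[in RHS](sY x) !sVK.
apply: trace_on_conj => //.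
- exact: module_homog_subspace.
- exact: module_homog_finite_dim.
- exact: (modes_linearr (module_opP N)).
- by move=> w; exact: zero_mode_homog.
- exact: sX.
- exact: sX.
Qed.

End Automorphisms.

Lemma minimal_weight_gap (R : realType) (V : voa R) (M : nat -> set V) t h :
  (t.+1%:R%:E <= minimal_weight M)%E -> (0 < h <= t)%N -> M h = [set 0].
Proof.
move=> tM /andP[h0 ht]; apply: contrapT => Mh.
have : (minimal_weight M <= h%:R%:E)%E by apply: ereal_inf_lbound; exists h.
by move=> /(le_trans tM); rewrite lee_fin ler_nat ltnNge ht.
Qed.

Unset Implicit Arguments.
Theorem theorem2p5 (R : realType) (V : voa R)
  (hC2 : C2_cofinite V)
  (pi : V -> V) (hpi : unique (vacuum_projection V) pi)
  (G : topologicalGroupType) (rho : G -> V -> V)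
  (hG : compact_lie_group_of_automorphisms rho)
  (N : voa_module V) (hN : G_invariant rho N)
  (X : set N) (hX : homogeneous_subspace X)
  (t : nat) (ht : (0 < t)%N)
  (MG : nat -> set V) (hMG : hw_decomposition (fixed_points rho) MG)
  (hmu : (t.+1%:R%:E <= minimal_weight MG)%E) :
  conformal_design pi t X.
Proof.
case: hX => h ->; move=> n nt v vn; apply/eqP; rewrite -subr_eq0; apply/eqP.
case: hG => _ Gco autV _ ctsG.
have [p [lp pU pid]] := @homog_projection R V n.
have [vpi _] := hpi.
have lpi : linear pi by case: vpi => M [].
pose tr u := trace_on (module_homog N h) (module_op N u (n%:Z - 1)).
pose phi u := tr u - tr (pi u).
apply: (compact_action_invariant_eq0
  (rho := rho) (phi := phi) Gco _ _ lp pU pid) vn.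
- exact: homog_subspace.
- exact: voa_finite_dim (voaP V) n.
- by case: autV.
- exact: ctsG.
- by move=> g u; exact: (aut_homog autV).
- move=> a u w un wn; rewrite /phi /tr lpi !trace_zero_mode_linear//;
    try exact: vacuum_projection_homog.
  by rewrite mulrBr opprD addrACA.
- move=> g u un; rewrite /phi /tr (vacuum_projection_aut autV)//.
  by rewrite (trace_zero_mode_aut autV).
- move=> u un fixu; suff uO : V_omega V u.
    by case: vpi => M [_ _ _ pio _]; rewrite /phi pio// subrr.
  apply: (hw_decomposition_low_degree hMG _ nt fixu un) => k.
  exact: minimal_weight_gap.
Qed.
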